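(* Let $(\mathfrak g,[-,-],(-)^{[p]})$ be a restricted Lie algebra over $\mathbf k$, let $\lambda\in\mathbf k$ with $\lambda\neq-1$, and let $R$ be an idempotent ($R^2=R$) Rota-Baxter operator of weight $\lambda$ on $\mathfrak g$. Then $R$ is restricted if and only if $R$ is a restricted Lie algebra homomorphism from $(\mathfrak g,[-,-]_\lambda,(-)^{[p]_\lambda})$ to $(\mathfrak g,[-,-],(-)^{[p]})$, where $[x,y]_\lambda=\lambda[x,y]$ and $x^{[p]_\lambda}=\lambda^{p-1}x^{[p]}$.
   Context: Convention: $\mathbf k$ is an algebraically closed field of prime characteristic $p$; everything is over $\mathbf k$. Restricted Lie algebra: a Lie algebra $(\mathfrak g,[-,-])$ with a $p$-map $(-)^{[p]}:\mathfrak g\to\mathfrak g$ satisfying $(ax)^{[p]}=a^px^{[p]}$ for $a\in\mathbf k$, $[x^{[p]},y]=(\mathrm{ad}_x)^p(y)$, and $(x+y)^{[p]}=x^{[p]}+y^{[p]}+\sum_{i=1}^{p-1}s_i(x,y)$, where $i\,s_i(x,y)$ is the coefficient of $t^{i-1}$ in $(\mathrm{ad}_{tx+y})^{p-1}(x)\in\mathbf k[t]\otimes\mathfrak g$. Restricted Lie algebra homomorphisms are Lie algebra homomorphisms commuting with the $p$-maps. Rota-Baxter operator of weight $\lambda$ on a Lie algebra $\mathfrak g$: a linear map $R:\mathfrak g\to\mathfrak g$ with $[R(x),R(y)]=R([R(x),y])+R([x,R(y)])+\lambda R([x,y])$ for all $x,y$. Put $x\rhd_Ry:=[R(x),y]$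 and $x^{\rhd_Rk}:=x\rhd_R(x\rhd_R\cdots(x\rhd_Rx)\cdots)$ ($k$ copies of $x$, $x^{\rhd_R1}=x$). For a composition $\alpha=(\alpha_1,\dots,\alpha_r)\vDash n$ (a tuple of positive integers with sum $n$, of length $\ell(\alpha)=r$), $C_\alpha=\prod_{k=1}^r\binom{\alpha_1+\cdots+\alpha_k-1}{\alpha_k-1}$. On a restricted Lie algebra $(\mathfrak g,[-,-],(-)^{[p]})$, a Rota-Baxter operator $R$ of weight $\lambda$ is called restricted if $R(x^{[p]_R})=R(x)^{[p]}$ for all $x\in\mathfrak g$, where $$x^{[p]_R}:=\lambda^{p-1}x^{[p]}+\sum_{r=1}^{p-1}\frac1r\lambda^{r-1}\sum_{\alpha\vDash p,\ \ell(\alpha)=r}C_\alpha\,[x^{\rhd_R\alpha_1},[x^{\rhd_R\alpha_2},[\cdots[x^{\rhd_R\alpha_{r-1}},x^{\rhd_R\alpha_r}]\cdots]]]$$ ($\lambda^0=1$; $\frac1r$ is the inverse of $r$ modulo $p$). *)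

(* Defs.v *)
From HB Require Import structures.
From mathcomp Require Import all_boot all_order all_algebra.

Set Implicit Arguments.
Unset Strict Implicit.
Unset Printing Implicit Defensive.

Import GRing.Theory.
Local Open Scope ring_scope.

Record lieAlgebra (k : fieldType) (g : lmodType k) := LieAlgebra {
  lie_bracket : g -> g -> g;
  lie_bracket_linearl : forall y, linear (fun x => lie_bracket x y);
  lie_bracket_linearr : forall x, linear (lie_bracket x);
  lie_bracket_alt : forall x, lie_bracket x x = 0;
  lie_bracket_jacobi : forall x y z,
    lie_bracket x (lie_bracket y z) + lie_bracket y (lie_bracket z x)
      + lie_bracket z (lie_bracket x y) = 0
}.

(* An element of k[t] (x) g is represented by the list of its coefficients
   (constant term first); this is the k[t]-bilinear extension of the bracket.
   The length bound is not sharp: trailing zeroes are harmless, as only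
   coefficients are ever read off. *)
Definition tpoly_bracket (k : fieldType) (g : lmodType k) (L : lieAlgebra g)
    (u v : seq g) : seq g :=
  mkseq (fun n => \sum_(i < n.+1) lie_bracket L u`_i v`_(n - i))
    (size u + size v).

(* The list [:: y; x] is the polynomial t x + y, and [:: x] the constant x. *)
Definition jacobson_s (k : fieldType) (p : nat) (g : lmodType k)
    (L : lieAlgebra g) (i : nat) (x y : g) : g :=
  (i%:R : k)^-1 *: (iter p.-1 (tpoly_bracket L [:: y; x]) [:: x])`_i.-1.

Record restrictedLieAlgebra (k : fieldType) (p : nat) (g : lmodType k) :=
  RestrictedLieAlgebra {
  rlie_lie :> lieAlgebra g;
  pmap : g -> g;
  pmapZ : forall (a : k) x, pmap (a *: x) = a ^+ p *: pmap x;
  pmap_ad : forall x y,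
    lie_bracket rlie_lie (pmap x) y = iter p (lie_bracket rlie_lie x) y;
  pmapD : forall x y,
    pmap (x + y)
      = pmap x + pmap y + \sum_(1 <= i < p) jacobson_s p rlie_lie i x y
}.

Definition lie_hom (k : fieldType) (g h : lmodType k)
    (L : lieAlgebra g) (M : lieAlgebra h) (f : {linear g -> h}) : Prop :=
  forall x y, f (lie_bracket L x y) = lie_bracket M (f x) (f y).

Definition restricted_lie_hom (k : fieldType) (p : nat) (g h : lmodType k)
    (L : restrictedLieAlgebra p g) (M : restrictedLieAlgebra p h)
    (f : {linear g -> h}) : Prop :=
  lie_hom L M f /\ forall x, f (pmap L x) = pmap M (f x).

Definition rota_baxter (k : fieldType) (g : lmodType k) (L : lieAlgebra g)
    (lam : k) (R : {linear g -> g}) : Prop :=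
  forall x y,
    lie_bracket L (R x) (R y)
      = R (lie_bracket L (R x) y) + R (lie_bracket L x (R y))
        + lam *: R (lie_bracket L x y).

(* With n copies of x, for n >= 1. *)
Definition rb_power (k : fieldType) (g : lmodType k) (L : lieAlgebra g)
    (R : g -> g) (x : g) (n : nat) : g :=
  iter n.-1 (lie_bracket L (R x)) x.

(* [y1, [y2, ... [y_(r-1), y_r] ... ]]; a single entry is left unchanged. *)
Fixpoint nested_bracket (k : fieldType) (g : lmodType k) (L : lieAlgebra g)
    (s : seq g) : g :=
  match s with
  | [::] => 0
  | [:: y] => y
  | y :: s' => lie_bracket L y (nested_bracket L s')
  end.

Definition is_composition (n : nat) (a : seq nat) : bool :=
  all (fun i => 0 < i)%N a && (sumn a == n).

Definition comp_coef (a : seq nat) : nat :=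
  (\prod_(j < size a) 'C((sumn (take j.+1 a)).-1, (nth 0 a j).-1))%N.

(* The compositions of p of length r are enumerated inside r.-tuple 'I_p.+1,
   since every part is at most p. *)
Definition rb_pmap (k : fieldType) (p : nat) (g : lmodType k)
    (L : restrictedLieAlgebra p g) (lam : k) (R : g -> g) (x : g) : g :=
  lam ^+ p.-1 *: pmap L x
  + \sum_(1 <= r < p) ((r%:R : k)^-1 * lam ^+ r.-1) *:
      \sum_(a : r.-tuple 'I_p.+1
              | is_composition p [seq nat_of_ord i | i <- a])
        (comp_coef [seq nat_of_ord i | i <- a])%:R *:
          nested_bracket L [seq rb_power L R x (nat_of_ord i) | i <- a].

Definition restricted_rota_baxter (k : fieldType) (p : nat) (g : lmodType k)
    (L : restrictedLieAlgebra p g) (lam : k) (R : {linear g -> g}) : Prop :=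
  forall x, R (rb_pmap L lam R x) = pmap L (R x).

Section Scaled.

Variables (k : fieldType) (p : nat) (g : lmodType k) (lam : k).

Section Lie.

Variable L : lieAlgebra g.

Definition scaled_bracket (x y : g) : g := lam *: lie_bracket L x y.

Fact scaled_bracket_linearl y : linear (fun x => scaled_bracket x y).
Proof.
move=> a u v; rewrite /scaled_bracket lie_bracket_linearl scalerDr.
by rewrite !scalerA mulrC.
Qed.

Fact scaled_bracket_linearr x : linear (scaled_bracket x).
Proof.
move=> a u v; rewrite /scaled_bracket lie_bracket_linearr scalerDr.
by rewrite !scalerA mulrC.
Qed.

Fact scaled_bracket_alt x : scaled_bracket x x = 0.
Proof. by rewrite /scaled_bracket lie_bracket_alt scaler0. Qed.

Fact lie_bracketZr x a y : lie_bracket L x (a *: y) = a *: lie_bracket L x y.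
Proof.
have h0 : lie_bracket L x 0 = 0.
  by have := lie_bracket_linearr L x (-1) 0 0; rewrite scaler0 addr0 scaleN1r addNr.
by have := lie_bracket_linearr L x a y 0; rewrite h0 !addr0.
Qed.

Fact lie_bracketZl x a y : lie_bracket L (a *: x) y = a *: lie_bracket L x y.
Proof.
have h0 : lie_bracket L 0 y = 0.
  by have := lie_bracket_linearl L y (-1) 0 0; rewrite scaler0 addr0 scaleN1r addNr.
by have := lie_bracket_linearl L y a x 0; rewrite h0 !addr0.
Qed.

Fact scaled_bracket_jacobi x y z :
  scaled_bracket x (scaled_bracket y z) + scaled_bracket y (scaled_bracket z x)
    + scaled_bracket z (scaled_bracket x y) = 0.
Proof.
by rewrite /scaled_bracket !lie_bracketZr -!scalerDr lie_bracket_jacobi !scaler0.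
Qed.

Definition scaled_lie : lieAlgebra g :=
  LieAlgebra scaled_bracket_linearl scaled_bracket_linearr
    scaled_bracket_alt scaled_bracket_jacobi.

Fact iter_scaled_bracket n x y :
  iter n (lie_bracket scaled_lie x) y = lam ^+ n *: iter n (lie_bracket L x) y.
Proof.
elim: n => [|n IHn] /=; first by rewrite scale1r.
by rewrite IHn /scaled_bracket lie_bracketZr scalerA -exprS.
Qed.

Fact iter_scaled_tpoly n (u v : seq g) i :
  let w := iter n (tpoly_bracket L u) v in
  let w' := iter n (tpoly_bracket scaled_lie u) v in
  size w' = size w /\ w'`_i = lam ^+ n *: w`_i.
Proof.
elim: n i => [|n IHn] i /=; first by rewrite scale1r.
have [szE _] := IHn 0%N; rewrite !size_mkseq szE; split=> //.
rewrite {1 3}/tpoly_bracket szE.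
have [lt_i|ge_i] := ltnP i (size u + size (iter n (tpoly_bracket L u) v)).
  rewrite !nth_mkseq // scaler_sumr; apply: eq_bigr => j _.
  have [_ ->] := IHn (i - j)%N.
  by rewrite /= /scaled_bracket lie_bracketZr scalerA -exprS.
by rewrite !nth_default ?size_mkseq // scaler0.
Qed.

Fact jacobson_s_scaled i x y :
  jacobson_s p scaled_lie i x y = lam ^+ p.-1 *: jacobson_s p L i x y.
Proof.
rewrite /jacobson_s.
have [_ ->] := iter_scaled_tpoly p.-1 [:: y; x] [:: x] i.-1.
by rewrite !scalerA mulrC.
Qed.

End Lie.

Hypothesis pcharp : p \in [pchar k].
Variable L : restrictedLieAlgebra p g.

Definition scaled_pmap (x : g) : g := lam ^+ p.-1 *: pmap L x.

Fact scaled_pmapZ (a : k) x : scaled_pmap (a *: x) = a ^+ p *: scaled_pmap x.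
Proof. by rewrite /scaled_pmap pmapZ !scalerA mulrC. Qed.

Fact scaled_pmap_ad x y :
  lie_bracket (scaled_lie L) (scaled_pmap x) y
    = iter p (lie_bracket (scaled_lie L) x) y.
Proof.
rewrite iter_scaled_bracket /= /scaled_bracket /scaled_pmap lie_bracketZl pmap_ad.
by rewrite scalerA -exprS prednK // prime_gt0 // (pcharf_prime pcharp).
Qed.

Fact scaled_pmapD x y :
  scaled_pmap (x + y) = scaled_pmap x + scaled_pmap y
    + \sum_(1 <= i < p) jacobson_s p (scaled_lie L) i x y.
Proof.
rewrite /scaled_pmap pmapD !scalerDr scaler_sumr; congr (_ + _).
by apply: eq_bigr => i _; rewrite jacobson_s_scaled.
Qed.

Definition scaled_restricted_lie : restrictedLieAlgebra p g :=
  RestrictedLieAlgebra scaled_pmapZ scaled_pmap_ad scaled_pmapD.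

End Scaled.

(* Main.v *)
Require Import Defs.
From mathcomp Require Import all_boot all_order all_algebra.

Set Implicit Arguments.
Unset Strict Implicit.
Unset Printing Implicit Defensive.

Import GRing.Theory.
Local Open Scope ring_scope.

(** Substituting [R x] for [x] and [R y] for [y] in the Rota-Baxter identity of
    an idempotent [R] gives [[R x, R y] = (2 + lam) R [R x, R y]].  Applying [R]
    and using [lam <> -1] yields [[R x, R y] = 0], then [R [R x, y] = 0], and
    finally [lam R [x, y] = 0].  Hence [R] is always a Lie homomorphism for the
    scaled bracket, and it kills every term of [rb_pmap] except
    [lam ^+ p.-1 *: pmap L x]: the term of length [1] is [[R x, _]] because
    [p > 1], and a term of length [r > 1] is a bracket with a factor [lam]. *)

Section IdempotentRotaBaxter.

Variables (k : fieldType) (g : lmodType k) (lam : k) (R : {linear g -> g}).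
Hypothesis lam_neqN1 : lam != -1.
Hypothesis R_idem : forall x, R (R x) = R x.

Lemma scale1D_eq0 (v : g) : (1 + lam) *: v = 0 -> v = 0.
Proof.
by move/eqP; rewrite scaler_eq0 addrC addr_eq0 (negPf lam_neqN1) => /eqP.
Qed.

Section Lie.

Variable L : lieAlgebra g.
Hypothesis rbR : rota_baxter L lam R.

Lemma idem_rb_bracket_image x y : lie_bracket L (R x) (R y) = 0.
Proof.
have e : lie_bracket L (R x) (R y)
    = (1 + (1 + lam)) *: R (lie_bracket L (R x) (R y)).
  rewrite !scalerDl !scale1r addrA.
  by have := rbR (R x) (R y); rewrite !R_idem.
suff R0 : R (lie_bracket L (R x) (R y)) = 0 by rewrite e R0 scaler0.
have := congr1 R e; rewrite linearZ /= R_idem scalerDl scale1r => /eqP.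
by rewrite -subr_eq0 opprD addrA subrr add0r oppr_eq0 => /eqP /scale1D_eq0.
Qed.

(** In the Rota-Baxter identity at [(R x, y)] the left side and the middle term vanish, leaving [(1
    + lam) *: R [R x, y] = 0]. *)
Lemma idem_rb_bracketl x y : R (lie_bracket L (R x) y) = 0.
Proof.
apply: scale1D_eq0; rewrite scalerDl scale1r; have := rbR (R x) y.
by rewrite !R_idem !idem_rb_bracket_image linear0 addr0 => <-.
Qed.

Lemma idem_rb_bracketr x y : R (lie_bracket L x (R y)) = 0.
Proof.
apply: scale1D_eq0; rewrite scalerDl scale1r; have := rbR x (R y).
by rewrite !R_idem !idem_rb_bracket_image linear0 add0r => <-.
Qed.

Lemma idem_rb_bracket_scaled x y : lam *: R (lie_bracket L x y) = 0.
Proof.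
have := rbR x y.
by rewrite idem_rb_bracket_image idem_rb_bracketl idem_rb_bracketr !add0r => <-.
Qed.

End Lie.

Lemma idem_rb_pmapE (p : nat) (L : restrictedLieAlgebra p g) x :
  (1 < p)%N -> rota_baxter L lam R ->
  R (rb_pmap L lam R x) = R (lam ^+ p.-1 *: Defs.pmap L x).
Proof.
move=> p_gt1 rbR; rewrite /rb_pmap linearD linear_sum /= big1_seq ?addr0 //= => r.
rewrite mem_index_iota => /andP[r_gt0 _].
rewrite -scalerA linearZ linearZ linear_sum /= [X in _ *: X]scaler_sumr.
rewrite big1 ?scaler0 // => a.
rewrite linearZ /= scalerA mulrC -scalerA => compa.
(* The power of [lam] is kept beside the bracket: for length at least 2 one factor [lam] makes it
   vanish. *)
suff -> : lam ^+ r.-1 *: R (nested_bracket L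
    [seq rb_power L R x (nat_of_ord i) | i <- a]) = 0 by rewrite scaler0.
case: r r_gt0 a compa => [//|[|r]] _ a.
  (* The only composition of length 1 is [p] itself. *)
  case/tupleP: a => i a; rewrite (tuple0 a) /= /is_composition /= addn0.
  case/andP=> _ /eqP ->; rewrite scale1r /rb_power.
  have -> : p.-1 = p.-2.+1 by rewrite prednK // -ltnS prednK // ltnW.
  by rewrite /= idem_rb_bracketl.
case/tupleP: a => i a; case/tupleP: a => j a _ /=.
by rewrite exprSr -scalerA idem_rb_bracket_scaled // scaler0.
Qed.

End IdempotentRotaBaxter.

Theorem theorem4p8 (k : closedFieldType) (p : nat) (pcharp : p \in [pchar k])
    (g : lmodType k) (L : restrictedLieAlgebra p g) (lam : k)
    (R : {linear g -> g}) :
  lam != -1 ->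
  (forall x, R (R x) = R x) ->
  rota_baxter L lam R ->
  (restricted_rota_baxter L lam R <->
   restricted_lie_hom (scaled_restricted_lie lam pcharp L) L R).
Proof.
move=> lamN1 R_idem rbR.
have p_gt1 : (1 < p)%N by rewrite prime_gt1 // (pcharf_prime pcharp).
have pmapE x := @idem_rb_pmapE _ _ _ _ lamN1 R_idem p L x p_gt1 rbR.
(* By [pmapE], being restricted and commuting with the [p]-maps are the same equation; only the
   brackets remain, where both sides are 0. *)
split=> [resR|[_ homR] x]; last by rewrite pmapE -homR.
split=> [x y|x]; last by rewrite -resR pmapE.
rewrite /= /scaled_bracket linearZ /=.
rewrite (@idem_rb_bracket_scaled _ _ lam) //.
by rewrite (@idem_rb_bracket_image _ _ lam).
Qed.
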